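(* For every $n\ge 1$, the set of ordered rooted trees with $n$ generators is in one-to-one correspondence with the set of Dyck paths of semilength $n$ in which each maximal ascent of length $j$ ($j=1,\dots,n$) is colored in one of $s_{j-1}$ different ways. In particular these two sets have the same cardinality.
   Context: A generator of an ordered rooted tree is a vertex that is either a leaf or has exactly one child. $s_m$ ($m\ge0$) denotes the little Schröder number: the number of lattice paths from $(0,0)$ to $(m,m)$ with steps $(1,0),(0,1),(1,1)$ staying weakly above $y=x$ and having no $(1,1)$-step on $y=x$; equivalently the number of ordered trees with no vertex of outdegree 1 having $m+1$ leaves. A colored Dyck path is a Dyck path together with a choice of color for each maximal ascent; two are equal only if paths and all colors agree. *)

(* Defs.v *)
From HB Require Import structures.
From mathcomp Require Import all_boot zify.

Set Implicit Arguments.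
Unset Strict Implicit.
Unset Printing Implicit Defensive.

Inductive otree : Type := Node of seq otree.

Fixpoint otree_encode (t : otree) : GenTree.tree unit :=
  let: Node ts := t in GenTree.Node 0 (map otree_encode ts).

Fixpoint otree_decode (t : GenTree.tree unit) : otree :=
  if t is GenTree.Node _ ts then Node (map otree_decode ts) else Node [::].

Lemma otree_encodeK : cancel otree_encode otree_decode.
Proof.
rewrite /cancel; fix IH 1; case=> ts /=; congr Node.
by elim: ts => [|t ts IHts] //=; rewrite IH IHts.
Qed.

HB.instance Definition _ := Countable.copy otree (can_type otree_encodeK).

Fixpoint generators (t : otree) : nat :=
  let: Node ts := t in
  ((size ts == 0) || (size ts == 1)) + sumn (map generators ts).

Definition gen_tree (n : nat) := {t : otree | generators t == n}.

(* [p] leads from (x, y) to (m, m); a step is its displacement (dx, dy), so   *)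
(* (true, false), (false, true) and (true, true) are (1,0), (0,1) and (1,1).  *)
Fixpoint schroder_path (m x y : nat) (p : seq (bool * bool)) : bool :=
  if p is (dx, dy) :: p' then
    [&& dx || dy, x + dx <= y + dy, ~~ [&& dx, dy & x == y] &
        schroder_path m (x + dx) (y + dy) p']
  else (x == m) && (y == m).

(* Shows that the bounded sequences in [little_schroder] omit no path.        *)
Lemma schroder_path_size m x y p :
  schroder_path m x y p -> size p + (x + y) <= m.*2.
Proof.
elim: p x y => [|[dx dy] p IH] x y /=.
  by move=> /andP[/eqP-> /eqP->]; rewrite add0n addnn.
case/and4P=> dxy _ _ /IH; apply: leq_trans.
by case: dx dy dxy => [] [] //= _; lia.
Qed.

Definition little_schroder (m : nat) : nat :=
  #|[set p : m.*2.-bseq (bool * bool) | schroder_path m 0 0 p]|.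

(* An up step is [true], a down step is [false].                              *)
Definition is_dyck (p : seq bool) : bool :=
  (count_mem true p == count_mem false p) &&
  all (fun k => count_mem false (take k p) <= count_mem true (take k p))
      (iota 0 (size p).+1).

Definition dyck_path (n : nat) := {p : n.*2.-tuple bool | is_dyck p}.

(* Lengths of the maximal runs of up steps of [p], from left to right, when   *)
(* [p] is preceded by [k] up steps.                                           *)
Fixpoint ascents_from (k : nat) (p : seq bool) : seq nat :=
  match p with
  | true :: p' => ascents_from k.+1 p'
  | false :: p' =>
      if k is 0 then ascents_from 0 p' else k :: ascents_from 0 p'
  | [::] => if k is 0 then [::] else [:: k]
  end.

Definition ascents (p : seq bool) : seq nat := ascents_from 0 p.

Definition ascent_coloring (p : seq bool) :=
  {dffun forall i : 'I_(size (ascents p)),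
     'I_(little_schroder (nth 0 (ascents p) i).-1)}.

Definition colored_dyck_path (n : nat) :=
  {p : dyck_path n & ascent_coloring (val p)}.

HB.instance Definition _ (n : nat) := Finite.on (colored_dyck_path n).

(* Main.v *)
Require Import Defs.
From mathcomp Require Import all_boot zify.

(* Let T, C and S be the generating functions of nonempty trees by generators,
   of colored Dyck paths by semilength, and of trees without unary vertices by
   leaves, so that S = sum_j s_(j-1) x^j. Cutting a tree below its unary
   vertices closest to the root leaves a tree without unary vertices, each leaf
   of which either was a leaf or carries a tree below a unary vertex:
   T = S(x (1 + T)). Splitting a Dyck path after its first ascent, of length j,
   leaves j Dyck paths, one after each matching down step: C = 1 + S(x C).
   Hence 1 + T = C. Both this and the count of trees by Schröder paths are
   proved by matching the first-step recurrences of paths (started at arbitrary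
   height) with decompositions of lists of trees. *)

Set Implicit Arguments.
Unset Strict Implicit.
Unset Printing Implicit Defensive.

(** * Counting by duplicate-free lists *)

(** [otree] is not a finite type, so a list that enumerates a set of trees replaces [#|_|]. *)
Definition counted (T : eqType) (P : pred T) (n : nat) : Prop :=
  exists s : seq T, [/\ uniq s, (forall x, (x \in s) = P x) & size s = n].

Section Counted.
Variables T U : eqType.
Implicit Types (P : pred T) (Q : pred U).

Lemma counted_eq P1 P2 n : P1 =1 P2 -> counted P1 n -> counted P2 n.
Proof.
by move=> eqP [s [us sP sn]]; exists s; split=> // x; rewrite sP eqP.
Qed.

Lemma counted0 P : (forall x, ~~ P x) -> counted P 0.
Proof. by move=> P0; exists [::]; split=> // x; rewrite (negPf (P0 x)). Qed.

Lemma counted1 P a : P =1 pred1 a -> counted P 1.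
Proof. by move=> Pa; exists [:: a]; split=> // x; rewrite inE Pa. Qed.

Lemma counted_inj P m n : counted P m -> counted P n -> m = n.
Proof.
move=> [s [us sP <-]] [s' [us' s'P <-]].
by apply/eqP; rewrite -uniq_size_uniq // => x; rewrite sP s'P.
Qed.

(** [f] and [g] are mutually inverse only on [P] and [Q]; their values elsewhere are arbitrary. *)
Lemma counted_can P Q (f : T -> U) (g : U -> T) n :
    (forall x, P x -> Q (f x) /\ g (f x) = x) ->
    (forall y, Q y -> P (g y) /\ f (g y) = y) ->
  counted P n -> counted Q n.
Proof.
move=> PQ QP [s [us sP <-]]; exists (map f s); rewrite size_map; split=> //.
  rewrite map_inj_in_uniq // => x y; rewrite !sP => /PQ[_ {2}<-] /PQ[_ {2}<-].
  by move=> ->.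
move=> y; apply/mapP/idP => [[x + ->]|/QP[Pgy fgy]].
  by rewrite sP => /PQ[].
by exists (g y); rewrite ?sP.
Qed.

Lemma counted_split P (A : pred T) m n :
    counted (fun x => P x && A x) m -> counted (fun x => P x && ~~ A x) n ->
  counted P (m + n).
Proof.
move=> [s [us sP <-]] [s' [us' s'P <-]]; exists (s ++ s'); rewrite size_cat.
split=> // [|x]; last by rewrite mem_cat sP s'P -andb_orr orbN andbT.
rewrite cat_uniq us us' andbT /=; apply/hasPn => x; rewrite s'P sP.
by case/andP=> _ /negPf ->; rewrite andbF.
Qed.

Lemma counted_prod P Q m n :
  counted P m -> counted Q n -> counted (fun xy => P xy.1 && Q xy.2) (m * n).
Proof.
move=> [s [us sP <-]] [s' [us' s'Q <-]].
exists [seq (x, y) | x <- s, y <- s']; rewrite size_allpairs; split=> //.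
  by rewrite allpairs_uniq // => -[? ?] [].
move=> [x y]; rewrite -sP -s'Q.
apply/allpairsP/andP => [[[a b] /= [? ? [-> ->]]]|[? ?]] //.
by exists (x, y).
Qed.

End Counted.

Lemma counted_sub (T : eqType) (F : finType) (P : pred T) (A : {pred F})
    (f : F -> T) :
    injective f -> (forall a, P (f a) = (a \in A)) ->
    (forall x, P x -> exists a, x = f a) ->
  counted P #|A|.
Proof.
move=> f_inj PA Pf; exists (map f (enum A)).
rewrite size_map -cardE map_inj_uniq // enum_uniq; split=> // x.
apply/mapP/idP => [[a + ->]|Px]; first by rewrite mem_enum PA.
by have [a xa] := Pf x Px; exists a; rewrite // mem_enum -PA -xa.
Qed.

Lemma counted_bijective (T : eqType) (x0 : T) (F : finType) (P : pred T) :
  counted P #|F| -> exists f : {x | P x} -> F, bijective f.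
Proof.
move=> [s [us sP sF]].
have idx (x : {x | P x}) : index (val x) s < #|F|.
  by rewrite -sF index_mem sP (valP x).
have nthP (y : F) : P (nth x0 s (enum_rank y)) by rewrite -sP mem_nth ?sF.
exists (fun x => enum_val (Ordinal (idx x))).
exists (fun y => exist (fun x => P x) _ (nthP y)).
  by move=> x; apply: val_inj; rewrite /= enum_valK /= nth_index // sP (valP x).
move=> y; rewrite -[RHS]enum_rankK; congr enum_val; apply: val_inj.
by rewrite /= index_uniq ?sF.
Qed.

(** * Schröder trees and Schröder paths *)

(** The principle generated for this nested type gives no hypothesis on the children. *)
Lemma otree_ind_mem (P : otree -> Prop) :
  (forall ts, (forall t, t \in ts -> P t) -> P (Node ts)) -> forall t, P t.
Proof.
move=> PN; fix IH 1; case=> ts; apply: PN.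
elim: ts => [|t ts IHts] u.
  rewrite in_nil => u_nil; discriminate.
rewrite inE => /orP[/eqP->|u_ts]; [exact: IH | exact: IHts].
Qed.

Fixpoint leaves (t : otree) : nat :=
  let: Node ts := t in (size ts == 0) + sumn (map leaves ts).

Fixpoint schroder_tree (t : otree) : bool :=
  let: Node ts := t in (size ts != 1) && all schroder_tree ts.

Lemma leaves_gt0 t : 0 < leaves t.
Proof.
elim/otree_ind_mem: t => -[|t ts] //= IH.
by rewrite add0n addn_gt0 IH // mem_head.
Qed.

Definition forest_leaves (ts : seq otree) := sumn (map leaves ts).

Lemma size_forest_leaves ts : size ts <= forest_leaves ts.
Proof.
elim: ts => //= t ts IH; rewrite /forest_leaves /= -add1n leq_add //.
exact: leaves_gt0.
Qed.

(* If R counts large Schröder paths by semilength, paths descending from height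
   d to the diagonal are counted by R^d (S/y). Nonempty lists of Schröder trees
   have generating function S/(1-S) = yR, whence the correspondence of
   [schroder_path_stack] between these paths and d such lists plus one tree. *)
Definition schroder_stack (d l : nat) (Lt : seq (seq otree) * otree) : bool :=
  [&& size Lt.1 == d,
      all (fun ts => (ts != [::]) && all schroder_tree ts) Lt.1,
      schroder_tree Lt.2 &
      sumn (map forest_leaves Lt.1) + leaves Lt.2 == l].

Lemma schroder_stack_leaves d l Lt : schroder_stack d l Lt -> d < l.
Proof.
case: Lt => L t /and4P[/= /eqP<- LN _ /eqP<-].
rewrite -addn1 leq_add ?leaves_gt0 //.
elim: L LN => //= ts L IH /andP[/andP[ts0 _] /IH leL].
rewrite -add1n leq_add //; apply: leq_trans (size_forest_leaves ts).
by case: ts ts0.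
Qed.

Lemma counted_bool (T : eqType) (P : pred T) a :
  (forall x, P x -> x = a) -> counted P (P a).
Proof.
move=> Pa; case Pa': (P a).
  by apply: (counted1 (a := a)) => x; apply/idP/eqP => [/Pa|->].
by apply: counted0 => x; apply: contraFN Pa' => Px; rewrite -(Pa _ Px).
Qed.

Lemma schroder_path_end m x y p : schroder_path m x y p -> y <= m.
Proof.
elim: p x y => [|[dx dy] p IH] x y /=; first by case/andP=> _ /eqP->.
by case/and4P=> _ _ _ /IH; apply: leq_trans; apply: leq_addr.
Qed.

Lemma counted_schroder_path_cons m x y dx dy n :
    [&& dx || dy, x + dx <= y + dy & ~~ [&& dx, dy & x == y]] ->
    counted (schroder_path m (x + dx) (y + dy)) n ->
  counted (fun p => schroder_path m x y p && (ohead p == Some (dx, dy))) n.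
Proof.
case/and3P=> s1 s2 s3.
apply: (@counted_can _ _ _ _ (cons (dx, dy)) behead) => [p|[|[a b] p]] //=.
  by rewrite s1 s2 s3 eqxx => ->.
by rewrite andbF.
by case/andP=> [/and4P[_ _ _ pP] /eqP[ea eb]]; move: pP; rewrite ea eb => ->.
Qed.

(** S = y + S (yR): a Schröder tree is a leaf or splits into its first subtree and the nonempty list
    of the others. *)
Lemma counted_schroder_stack0 l n :
    counted (schroder_stack 1 l) n ->
  counted (schroder_stack 0 l) ((l == 1) + n).
Proof.
move=> cn.
pose A (Lt : seq (seq otree) * otree) := let: Node ts := Lt.2 in nilp ts.
apply: (counted_split (A := A)).
  pose P Lt := schroder_stack 0 l Lt && A Lt.
  have -> : (l == 1) = P ([::], Node [::]).
    by rewrite /P /schroder_stack /= andbT eq_sym.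
  by apply: counted_bool => -[L [ts]] /andP[/and4P[/nilP/= -> _ _ _] /nilP/= ->].

move: cn; apply: (@counted_can _ _ _ _
  (fun Lt => ([::], Node (Lt.2 :: head [::] Lt.1)))
  (fun Lt => if Lt.2 is Node (t :: ts) then ([:: ts], t) else Lt)).
  move=> [[|[|u ts] [|? ?]] t] //=;
    rewrite /schroder_stack /= ?andbF //.
  rewrite !andbT !add0n /forest_leaves /= !addn0.
  case/and3P=> /andP[-> ->] -> /eqP<-; split=> //=.
  by apply/eqP; lia.
move=> [[|? ?] [[|t [|u ts]]]] //=;
    rewrite /schroder_stack /= ?andbF //.
rewrite !andbT !add0n /forest_leaves /= => /andP[/and3P[-> -> ->] /eqP<-].
by split=> //=; apply/eqP; lia.
Qed.

(* yR = y + y (yR) + (yR)^2: the first list of the stack is [leaf], or leaf :: l,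
   or Node (t :: ts) :: us, which is split into the lists ts and t :: us. *)
Lemma counted_schroder_stackS d l a b c :
    counted (schroder_stack d.+2 l.+1) a ->
    counted (schroder_stack d.+1 l) b -> counted (schroder_stack d l) c ->
  counted (schroder_stack d.+1 l.+1) (a + (b + c)).
Proof.
move=> ca cb cc.
pose A (Lt : seq (seq otree) * otree) :=
  if Lt.1 is (Node [::] :: _) :: _ then false else true.
pose B (Lt : seq (seq otree) * otree) :=
  if Lt.1 is [:: _] :: _ then false else true.
apply: (counted_split (A := A)); last apply: (counted_split (A := B)).
- move: ca; apply: (@counted_can _ _ _ _
    (fun Lt => if Lt.1 is ts :: (t :: us) :: L
               then ((Node (t :: ts) :: us) :: L, Lt.2) else Lt)
    (fun Lt => if Lt.1 is (Node (t :: ts) :: us) :: L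
               then (ts :: (t :: us) :: L, Lt.2) else Lt)).
    move=> [[|[|v ts] [|[|u us] L]] t] //=;
    rewrite /schroder_stack /= ?andbF //.
    rewrite /forest_leaves /= => /and4P[sL + -> /eqP<-].
    case/and3P=> /andP[-> ->] /andP[-> ->] ->.
    rewrite !eqSS in sL *; rewrite sL; split=> //=.
    by rewrite ?andbT; apply/eqP; lia.
  move=> [[|[|[[|u [|v ts]]] us] L] t] //=;
    rewrite /schroder_stack /= ?andbF //.
  rewrite /forest_leaves /= => /andP[/and4P[sL + -> /eqP<-] _].
  case/andP=> /andP[/and3P[-> -> ->] ->] ->.
  rewrite !eqSS in sL *; rewrite sL; split=> //=.
  by apply/eqP; lia.
- move: cb; apply: (@counted_can _ _ _ _
    (fun Lt => if Lt.1 is us :: L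
               then ((Node [::] :: us) :: L, Lt.2) else Lt)
    (fun Lt => if Lt.1 is (_ :: us) :: L then (us :: L, Lt.2) else Lt)).
    move=> [[|[|u us] L] t] //=;
    rewrite /schroder_stack /= ?andbF //.
    rewrite /forest_leaves /= => /and4P[-> /andP[/andP[-> ->] ->] -> /eqP<-].
    by split=> //=; rewrite /A /B /= !andbT; apply/eqP; lia.
  move=> [[|[|[[|? ?]] [|u us]] L] t] //=;
    rewrite /schroder_stack /A /B /= ?andbF //.
  rewrite !andbT /forest_leaves /=.
  case/and4P=> -> /andP[/andP[-> ->] ->] -> /eqP sl.
  by split=> //=; apply/eqP; lia.
move: cc; apply: (@counted_can _ _ _ _
  (fun Lt => ([:: Node [::]] :: Lt.1, Lt.2))
  (fun Lt => (behead Lt.1, Lt.2))).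
  move=> [L t] //=;
    rewrite /schroder_stack /A /B /= => /and4P[sL -> -> /eqP<-].
  by rewrite eqSS sL /forest_leaves /= !add1n addSn eqxx.
move=> [[|[|[[|? ?]] [|u us]] L] t] //=;
    rewrite /schroder_stack /A /B /= ?andbF //.
rewrite !andbT /forest_leaves /= eqSS.
by case/and4P=> -> -> -> /eqP sl; split=> //=; apply/eqP; lia.
Qed.

(** Both counts obey the same recurrence, so induction yields a common value without a formula for
    it. *)
Lemma schroder_path_stack m x d :
  exists n, counted (schroder_path m x (x + d)) n /\
            counted (schroder_stack d (m.+1 - x)) n.
Proof.
(* The measure is 2(m+1) minus the coordinate sum of the point; the surplus 2 keeps it decreasing
   even at (m, m). *)
have [k] := ubnP (m.+1.*2 - (x + x + d)).
elim: k x d => // k IH x d lek.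
have [lt_m|le_m] := ltnP m (x + d).
  exists 0; split; apply: counted0 => p; apply/negP.
    by move/schroder_path_end; lia.
  by move/schroder_stack_leaves; lia.
case: d => [|d] in le_m lek *.
  (* On the diagonal a path can only stop, if at (m, m), or go up. *)
  have [|n [pn sn]] := IH x 1; first by lia.
  exists ((x == m) + n); split; last first.
    rewrite (_ : (x == m) = (m.+1 - x == 1)); last by apply/eqP/eqP; lia.
    exact: counted_schroder_stack0.
  apply: (counted_split (A := fun p => p == [::])).
    pose P p := schroder_path m x (x + 0) p && (p == [::]).
    have -> : (x == m) = P [::] by rewrite /P /= eqxx addn0 andbb andbT.
    by apply: counted_bool => p /andP[_ /eqP].
  have: counted (schroder_path m (x + false) (x + 0 + true)) n.
    by rewrite !addn0.
  move/counted_schroder_path_cons; rewrite addn0 /= => /(_ _)/counted_eq; apply;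
    last by rewrite leq_addr.
  by case=> [|[[] []] p] //=; rewrite ?eqxx ?andbT ?addn0 ?addn1 ?ltnn ?andbF.
(* Off the diagonal: first steps (0,1), (1,1) and (1,0), in this order. *)
have [|a [pa sa]] := IH x d.+2; first by lia.
have [|b [pb sb]] := IH x.+1 d.+1; first by lia.
have [|c [pc sc]] := IH x.+1 d; first by lia.
exists (a + (b + c)); split; last first.
  rewrite subSn; last by lia.
  by apply: counted_schroder_stackS; rewrite -?subSn // -?subSS; lia.
apply: (counted_split (A := fun p => ohead p == Some (false, true))).
  by apply: counted_schroder_path_cons; rewrite ?addn0 ?addn1 /=; [lia|rewrite -addnS].
apply: (counted_split (A := fun p => ohead p == Some (true, true))).
  have: counted (schroder_path m (x + true) (x + d.+1 + true)) b.
    by rewrite !addn1 -addSn.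
  move/counted_schroder_path_cons => /(_ _)/counted_eq; apply; last by lia.
  by move=> [|[[] []] p] //=; rewrite ?andbF ?andbT.
have: counted (schroder_path m (x + true) (x + d.+1 + false)) c.
  by rewrite addn1 addn0 -addSnnS.
move/counted_schroder_path_cons => /(_ _)/counted_eq; apply; last by lia.
move=> [|[[] []] p] //=; rewrite ?andbF ?andbT //.
by apply/esym/negbTE; lia.
Qed.

Lemma counted_little_schroder m :
  counted (schroder_path m 0 0) (little_schroder m).
Proof.
rewrite /little_schroder; apply: (counted_sub (f := val)) => [|a|p pP].
- exact: val_inj.
- by rewrite inE.
have sp : size p <= m.*2.
  by rewrite -(addn0 (size p)); exact: schroder_path_size pP.
by exists (Bseq sp).
Qed.

(** The case x = d = 0 of the correspondence: the stack is a single tree. *)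
Lemma counted_schroder_tree m :
  counted (fun t => schroder_tree t && (leaves t == m.+1)) (little_schroder m).
Proof.
have [n [pn sn]] := schroder_path_stack m 0 0.
rewrite (counted_inj (counted_little_schroder m) pn); move: sn.
apply: (@counted_can _ _ _ _ snd (fun t => ([::], t))) => [[[|? ?] t]|t] //=.
Qed.

(** * Cutting trees at their topmost unary vertices *)

(* [trunk t] cuts [t] below its topmost unary vertices; [branches t] lists, at
   the leaves of the trunk, what was cut off ([None] at a leaf of [t]). *)
Fixpoint trunk (t : otree) : otree :=
  let: Node ts := t in
  if size ts == 1 then Node [::] else Node (map trunk ts).

Fixpoint branches (t : otree) : seq (option otree) :=
  let: Node ts := t in
  match ts with
  | [::] => [:: None]
  | [:: u] => [:: Some u]
  | _ => flatten (map branches ts)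
  end.

(** [g] is bound outside the [fix] so that [graft] passes the guard condition. *)
Definition graft_forest (g : otree -> seq (option otree) -> otree) :=
  fix gf (ts : seq otree) (f : seq (option otree)) : seq otree :=
    if ts is t :: ts'
    then g t (take (leaves t) f) :: gf ts' (drop (leaves t) f) else [::].

Fixpoint graft (t : otree) (f : seq (option otree)) : otree :=
  let: Node ts := t in
  match ts, f with
  | [::], Some u :: _ => Node [:: u]
  | _, _ => Node (graft_forest graft ts f)
  end.

Definition forest_generators (f : seq (option otree)) : nat :=
  sumn (map (oapp generators 0) f).

Lemma forest_generators_cat f1 f2 :
  forest_generators (f1 ++ f2) = forest_generators f1 + forest_generators f2.
Proof. by rewrite /forest_generators map_cat sumn_cat. Qed.

Lemma trunk_Node ts : 1 < size ts -> trunk (Node ts) = Node (map trunk ts).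
Proof. by case: ts => [|? []]. Qed.

Lemma branches_Node ts :
  1 < size ts -> branches (Node ts) = flatten (map branches ts).
Proof. by case: ts => [|? []]. Qed.

Lemma leaves_Node ts : 1 < size ts -> leaves (Node ts) = sumn (map leaves ts).
Proof. by case: ts. Qed.

Lemma graft_Node ts f :
  1 < size ts -> graft (Node ts) f = Node (graft_forest graft ts f).
Proof. by case: ts. Qed.

Lemma size_branches t : size (branches t) = leaves (trunk t).
Proof.
elim/otree_ind_mem: t => ts IH.
have [ts1|] := ltnP 1 (size ts); last by case: ts {IH} => [|? []].
rewrite trunk_Node // branches_Node // leaves_Node ?size_map // {ts1}.
elim: ts IH => //= t ts IHts IH.
rewrite size_cat IH ?mem_head // IHts // => u u_ts.
by rewrite IH // inE u_ts orbT.
Qed.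

Lemma schroder_tree_trunk t : schroder_tree (trunk t).
Proof.
elim/otree_ind_mem: t => ts IH.
have [ts1|] := ltnP 1 (size ts); last by case: ts {IH} => [|? []].
rewrite trunk_Node //= size_map neq_ltn ts1 orbT all_map; exact/allP.
Qed.

(** A leaf of the trunk comes from a leaf or a unary vertex of [t], a generator either way; all
    other generators lie in the branches. *)
Lemma generators_branches t :
  forest_generators (branches t) + leaves (trunk t) = generators t.
Proof.
elim/otree_ind_mem: t => ts IH.
have [ts1|] := ltnP 1 (size ts); last first.
  by case: ts {IH} => [|t []] //= _; rewrite /forest_generators /= addnC.
rewrite trunk_Node // branches_Node // leaves_Node ?size_map //=.
rewrite gtn_eqF 1?ltnW // gtn_eqF // add0n {ts1}.
elim: ts IH => //= t ts IHts IH.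
rewrite forest_generators_cat -IH ?mem_head // -IHts 1?addnACA // => u u_ts.
by rewrite IH // inE u_ts orbT.
Qed.

Lemma branchesK t : graft (trunk t) (branches t) = t.
Proof.
elim/otree_ind_mem: t => ts IH.
have [ts1|] := ltnP 1 (size ts); last by case: ts {IH} => [|? []].
rewrite trunk_Node // branches_Node // graft_Node ?size_map // {ts1}.
congr Node; elim: ts IH => //= t ts IHts IH.
rewrite take_size_cat ?drop_size_cat ?size_branches // IH ?mem_head //.
by rewrite IHts // => u u_ts; rewrite IH // inE u_ts orbT.
Qed.

Lemma graftK t f :
  schroder_tree t -> size f = leaves t ->
  trunk (graft t f) = t /\ branches (graft t f) = f.
Proof.
elim/otree_ind_mem: t f => ts IH f.
have [ts1|] := ltnP 1 (size ts); last first.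
  by case: ts {IH} => [|? []] //= _ _; case: f => [|[u|] []].
(* Grafting keeps the number of children, so the root is still not unary. *)
have sg : 1 < size (graft_forest graft ts f).
  suff -> : size (graft_forest graft ts f) = size ts by [].
  by elim: ts f {IH ts1} => //= t ts IHts f; rewrite IHts.
rewrite graft_Node // trunk_Node // branches_Node // leaves_Node //=.
case/andP=> _ sch sf; suff [-> ->] :
    map trunk (graft_forest graft ts f) = ts /\
    flatten (map branches (graft_forest graft ts f)) = f by [].
elim: ts f IH sch sf {ts1 sg} => [|t ts IHts] f IH /=.
  by move=> _ /size0nil ->.
case/andP=> sch_t sch sf.
have [] := IH t (mem_head _ _) (take (leaves t) f) sch_t.
  by rewrite size_takel // sf leq_addr.
move=> -> ->; have [u u_ts||-> ->] := IHts (drop (leaves t) f) _ sch.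
- by apply: IH; rewrite inE u_ts orbT.
- by rewrite size_drop sf addKn.
by rewrite cat_take_drop.
Qed.

(** * Suffixes of colored Dyck paths as lists of trees *)

(** At [k = 0] no ascent is open and there is nothing to color. *)
Definition run_weight (k : nat) : nat :=
  if k is j.+1 then little_schroder j else 1.

(* The number of colored ways to end a Dyck path with [l] steps from height [h],
   when the [k] steps just before were up steps. *)
Fixpoint colored_suffixes (l k h : nat) : nat :=
  match l with
  | 0 => if h is 0 then run_weight k else 0
  | l'.+1 =>
      colored_suffixes l' k.+1 h.+1 +
      (if h is h'.+1 then run_weight k * colored_suffixes l' 0 h' else 0)
  end.

(** The [h] down steps to new minima separate [h.+1] Dyck paths; a tree with g generators stands for
    one of semilength g, [None] for the empty one. *)
Definition branch_forest (l h : nat) (f : seq (option otree)) : bool :=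
  (size f == h.+1) && ((forest_generators f).*2 + h == l).

(* What remains to be read of a colored Dyck path inside an ascent that has
   already reached length [k]: [t] is the color of this ascent, whose total
   length is [leaves t], and [f] is the list of trees for the Dyck paths that
   follow the down steps. *)
Definition trunk_forest (l k h : nat)
    (tf : otree * seq (option otree)) : bool :=
  [&& schroder_tree tf.1, k <= leaves tf.1,
      size tf.2 + k == h + leaves tf.1 &
      (forest_generators tf.2).*2 + size tf.2 + leaves tf.1 == l + k].

(** The ascent ends here: its color is chosen and a down step leads to height [h]. *)
Lemma counted_trunk_forest_min l k h n :
    counted (branch_forest l h) n ->
  counted (fun tf => trunk_forest l.+1 k.+1 h.+1 tf && (leaves tf.1 == k.+1))
    (little_schroder k * n).
Proof.
move/(counted_prod (counted_schroder_tree k)); apply: counted_eq => -[t f] /=.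
rewrite /trunk_forest /branch_forest /=.
case: (schroder_tree t) => //=; case: eqP => [->|_]; rewrite ?andbF //= andbT.
lia.
Qed.

(** An up step opens a nonempty Dyck path: the trunk of its tree colors the first ascent, the
    branches are the paths after the matching down steps. *)
Lemma counted_branch_forest l h n :
    counted (trunk_forest l 1 h.+1) n ->
  counted (fun f => branch_forest l.+1 h f && (ohead f != Some None)) n.
Proof.
apply: (@counted_can _ _ _ _
  (fun tf => Some (graft tf.1 (take (leaves tf.1) tf.2)) ::
             drop (leaves tf.1) tf.2)
  (fun f => if f is Some t :: f' then (trunk t, branches t ++ f')
            (* Never reached: [f] is nonempty and its head is not [None]. *)
            else (Node [::], f))).
  move=> [t f] /and4P[/= sch_t lt0 /eqP sf /eqP gf].
  (* lia treats sizes at the canonical eqType carrier as distinct atoms *)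
  change (seq (option otree)) in (type of f).
  have sft : size (take (leaves t) f) = leaves t by rewrite size_takel //; lia.
  have [trK brK] := graftK sch_t sft.
  rewrite trK brK cat_take_drop andbT; split=> //.
  rewrite /branch_forest /= size_drop /forest_generators /=.
  rewrite -/(forest_generators _) -(generators_branches (graft _ _)) trK brK.
  move: gf; rewrite -{1}(cat_take_drop (leaves t) f) forest_generators_cat.
  lia.
move=> [|[t|] f] //=; rewrite /branch_forest ?andbF //= andbT eqSS.
rewrite /forest_generators /= -/(forest_generators _) => /andP[/eqP sf /eqP gf].
have lt0 := leaves_gt0 (trunk t).
rewrite take_size_cat ?drop_size_cat ?size_branches // branchesK; split=> //.
rewrite /trunk_forest /= schroder_tree_trunk lt0 size_cat size_branches.
rewrite forest_generators_cat; have := generators_branches t; lia.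
Qed.

Lemma generators_gt0 t : 0 < generators t.
Proof. by rewrite -generators_branches addn_gt0 leaves_gt0 orbT. Qed.

(** Both claims go by one induction on [l], since an up step leads to [k > 0] and a down step to
    [k = 0]. *)
Lemma counted_colored_suffixes l h :
  counted (branch_forest l h) (colored_suffixes l 0 h) /\
  (forall k, counted (trunk_forest l k.+1 h) (colored_suffixes l k.+1 h)).
Proof.
elim: l h => [|l IH] h.
  split=> [|k].
    case: h => [|h] /=.
      apply: (@counted_bool _ (branch_forest 0 0) [:: None]).
      move=> [|[t|] [|? f]]; rewrite /branch_forest //= /forest_generators /=.
      by have := generators_gt0 t; lia.
    by apply: counted0 => f; rewrite /branch_forest; lia.
  case: h => [|h] /=; last first.
    by apply: counted0 => -[t f]; rewrite /trunk_forest /=; lia.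
  move: (counted_schroder_tree k).
  apply: (@counted_can _ _ _ _ (fun t => (t, [::])) fst) => [t|[t f]].
    rewrite /trunk_forest /forest_generators /= => /andP[-> /eqP->].
    by rewrite leqnn !eqxx.
  rewrite /trunk_forest /= => /and4P[-> kt st lt].
  change (seq (option otree)) in (type of f).
  have [sf tk] : size f = 0 /\ leaves t = k.+1 by lia.
  by rewrite tk eqxx (size0nil sf).
split=> [|k]; rewrite /=.
  (* A head [None] is an empty path, so a down step follows. *)
  rewrite addnC; apply: (counted_split (A := fun f => ohead f == Some None)).
    case: h => [|h].
      by apply: counted0 => -[|[t|] [|? f]]; rewrite /branch_forest ?andbF.
    rewrite mul1n; move: (IH h).1.
    apply: (@counted_can _ _ _ _ (cons None) behead) => [f|[|[t|] f]];
      rewrite /branch_forest ?andbF //= ?andbT eqSS /forest_generators /= add0n.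
      by rewrite addnS eqSS.
    by rewrite addnS eqSS.
  exact: counted_branch_forest ((IH h.+1).2 0).
(* The ascent stops exactly when it has as many steps as its color has leaves; otherwise the same
   pair describes the rest after an up step. *)
rewrite addnC; apply: (counted_split (A := fun tf => leaves tf.1 == k.+1)).
  case: h => [|h].
    apply: counted0 => -[t [|u f]];
      rewrite /trunk_forest /forest_generators /=; lia.
  exact: counted_trunk_forest_min (IH h).1.
apply: counted_eq ((IH h.+1).2 k.+1) => -[t f].
by rewrite /trunk_forest /=; case: (schroder_tree t) => //=; lia.
Qed.

(** * Cardinality of the colored Dyck paths *)

Fixpoint dyck_suffix (h : nat) (p : seq bool) : bool :=
  match p with
  | [::] => h == 0
  | true :: p' => dyck_suffix h.+1 p'
  | false :: p' => if h is h'.+1 then dyck_suffix h' p' else false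
  end.

Lemma dyck_suffixE h p :
  dyck_suffix h p = (h + count_mem true p == count_mem false p) &&
    all (fun k => count_mem false (take k p) <= h + count_mem true (take k p))
        (iota 0 (size p).+1).
Proof.
elim: p h => [|b p IH] h; first by rewrite /= addn0 !andbT.
rewrite [size _]/= -[iota 0 _]/(0 :: iota (1 + 0) (size p).+1) iotaDl.
(* After the shift, 0 stands for the prefix of length 1, which fails when a down step starts at
   height 0. *)
have: 0 \in iota 0 (size p).+1 by [].
move: (iota 0 _) IH => s IH s0; rewrite /= all_map.
case: b => /=.
  rewrite IH add0n add1n addnS -addSn; congr (_ && _); apply: eq_all => k /=.
  by rewrite add0n add1n addnS -addSn.
case: h => [|h].
  apply/esym/negbTE/nandP; right; apply/allPn; exists 0 => //=.
  by rewrite take0.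
by rewrite IH add0n add1n addSn eqSS.
Qed.

Lemma is_dyckE p : is_dyck p = dyck_suffix 0 p.
Proof. by rewrite dyck_suffixE. Qed.

Lemma big_tuple_cons (l : nat) (P : pred (seq bool)) (F : seq bool -> nat) :
  \sum_(p : l.+1.-tuple bool | P p) F p =
  \sum_(p : l.-tuple bool | P (true :: p)) F (true :: p) +
  \sum_(p : l.-tuple bool | P (false :: p)) F (false :: p).
Proof.
pose c (bp : bool * l.-tuple bool) := [tuple of bp.1 :: bp.2].
pose d (p : l.+1.-tuple bool) := (thead p, [tuple of behead p]).
rewrite (reindex c); last first.
  exists d => [[b p] _|p _]; last by rewrite /c /= -tuple_eta.
  by congr pair; apply: val_inj.
have := pair_big_dep xpredT (fun b (p : l.-tuple bool) => P (b :: p))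
  (fun b p => F (b :: p)) => /= <-.
by rewrite big_bool.
Qed.

(** First-step recurrence: a down step after [k > 0] up steps closes an ascent and contributes its
    factor. *)
Lemma sum_run_weight l k h :
  \sum_(p : l.-tuple bool | dyck_suffix h p)
     \prod_(a <- ascents_from k p) little_schroder a.-1 =
  colored_suffixes l k h.
Proof.
elim: l k h => [|l IH] k h.
  case: h => [|h]; last by rewrite big_pred0 // => p; rewrite tuple0.
  rewrite (big_pred1 [tuple]) => [|p]; last by rewrite tuple0; apply/esym/eqP.
  by case: k => [|k] /=; rewrite ?big_nil // big_seq1.
rewrite (big_tuple_cons l (dyck_suffix h) (fun p =>
  \prod_(a <- ascents_from k p) little_schroder a.-1)) /= IH.
congr (_ + _); case: h => [|h]; first by rewrite big_pred0.
rewrite -IH big_distrr; apply: eq_bigr => p _.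
by case: k => [|k] /=; rewrite ?mul1n // big_cons.
Qed.

Lemma card_colored_dyck_path n :
  #|{: colored_dyck_path n}| = colored_suffixes n.*2 0 0.
Proof.
rewrite -sum_run_weight.
under eq_bigl => p do rewrite -is_dyckE.
have card_coloring (p : dyck_path n) : #|ascent_coloring (val p)| =
    \prod_(a <- ascents (val p)) little_schroder a.-1.
  rewrite card_dep_ffun foldrE big_map big_enum /= (big_nth 0) big_mkord.
  by apply: eq_bigr => i _; rewrite card_ord.
rewrite card_tagged sumnE big_map big_enum /=.
rewrite (eq_bigr _ (fun p _ => card_coloring p)).
exact/esym/(big_sub (fun p : n.*2.-tuple bool => is_dyck p)).
Qed.

(** At height 0 the list has one entry, and [0 < n] excludes [None]. *)
Lemma counted_generators n :
  0 < n -> counted (fun t => generators t == n) (colored_suffixes n.*2 0 0).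
Proof.
move=> n_gt0; move: (counted_colored_suffixes n.*2 0).1.
apply: (@counted_can _ _ _ _
  (fun f => if f is Some t :: _ then t else Node [::])
  (fun t => [:: Some t])) => [[|[t|] [|? f]]|t] //=.
- rewrite /branch_forest /forest_generators /= !addn0 => /eqP/double_inj ->.
  by rewrite eqxx.
- by rewrite /branch_forest /forest_generators /=; lia.
by rewrite /branch_forest /forest_generators /= !addn0 => /eqP->.
Qed.

Theorem theorem4p1 (n : nat) (hn : 1 <= n) :
  (exists f : gen_tree n -> colored_dyck_path n, bijective f) /\
  (exists s : seq otree,
     [/\ uniq s,
         (forall t : otree, (t \in s) = (generators t == n)) &
         size s = #|{: colored_dyck_path n}|]).
Proof.
have cn := counted_generators hn; rewrite -card_colored_dyck_path in cn.
split; last exact: cn.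
exact: (counted_bijective (Node [::]) cn).
Qed.
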